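(* Suppose that $\mathcal{B}$ is invertible and that $\mathcal{S}=\mathcal{C}\mathcal{B}^{-1}\mathcal{C}^T+\mathcal{D}$ is positive definite. Then for every right-hand side $f_x$ and every initial vector $y^{(0)}$, the iterates $$y^{(k+1)}=y^{(k)}+\mathcal{S}_{\mathrm{diag}}^{-1}\bigl(f_x-\mathcal{S}y^{(k)}\bigr),\qquad k=0,1,2,\dots,$$ converge to $y=\mathcal{S}^{-1}f_x$.
   Context: Let $\mathbb{D}=(\mathbb{V},\mathbb{A})$ be a directed rooted tree (arborescence) with vertices $\mathbb{V}=\{1,\dots,N\}$ and arcs $\mathbb{A}=\{a_1,\dots,a_M\}$ directed away from the root $R\in\mathbb{V}$. Each vertex $i$ has a symmetric matrix $B_i\in\mathbb{R}^{n_i\times n_i}$; each arc $a_k=(i,j)$ has a symmetric matrix $D_k\in\mathbb{R}^{\ell_k\times \ell_k}$ and coupling matrices $C_k^+\in\mathbb{R}^{\ell_k\times n_i}$, $C_k^-\in\mathbb{R}^{\ell_k\times n_j}$. Put $\mathcal{B}=\mathrm{blkdiag}(B_1,\dots,B_N)$, $\mathcal{D}=\mathrm{blkdiag}(D_1,\dots,D_M)$, and let $\mathcal{C}=(\mathcal{C}_{k,i})$ be the block matrix (block rows $k\in\{1,\dots,M\}$, block columns $i\in\mathbb{V}$) with $\mathcal{C}_{k,i}=C_k^+$ if $i$ is the tail of $a_k$, $\mathcal{C}_{k,i}=-C_k^-$ if $i$ is the head of $a_k$, and $\mathcal{C}_{k,i}=0$ otherwise (an arc $(i,j)$ has tail $i$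 and head $j$). The symmetric matrix $\mathcal{S}$ has rows and columns naturally indexed by arcs (with $\ell_k$ rows/columns for arc $a_k$). An inner vertex is a vertex with at least one outgoing arc. Group the arcs by their tails: for inner vertices $i,j$ let $\mathcal{S}_{i,j}$ be the submatrix of $\mathcal{S}$ with rows belonging to the outgoing arcs of $i$ and columns belonging to the outgoing arcs of $j$. After ordering the arcs accordingly, $\mathcal{S}=(\mathcal{S}_{i,j})_{i,j\text{ inner}}$, and $\mathcal{S}_{\mathrm{diag}}$ is the block-diagonal matrix with diagonal blocks $\mathcal{S}_{i,i}$, $i$ ranging over the inner vertices (it is invertible because $\mathcal{S}$ is positive definite). *)

(* Defs.v *)
From HB Require Import structures.
From mathcomp Require Import all_boot all_order all_algebra.
From mathcomp Require Import all_classical all_reals all_analysis.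

Set Implicit Arguments.
Unset Strict Implicit.
Unset Printing Implicit Defensive.

Import Order.TTheory GRing.Theory Num.Theory.
Import numFieldNormedType.Exports.
Local Open Scope ring_scope.

(* A digraph on the vertices 'I_N is the family [a] of its M arcs; the arc
   [a k = (i, j)] has tail [i = (a k).1] and head [j = (a k).2]. *)

Fixpoint dwalk (N M : nat) (a : 'I_M -> 'I_N * 'I_N) (u : 'I_N)
    (w : seq 'I_M) (v : 'I_N) : bool :=
  if w is k :: w' then ((a k).1 == u) && dwalk a (a k).2 w' v else u == v.

(* Walks are sequences of arc indices, so uniqueness also forbids parallel
   arcs; the case v = r forbids directed cycles through the root. *)
Definition arborescence (N M : nat) (a : 'I_M -> 'I_N * 'I_N) (r : 'I_N) : Prop :=
  forall v : 'I_N, exists! w : seq 'I_M, dwalk a r w v.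

Definition posdefmx (R : realType) (m : nat) (A : 'M[R]_m) : Prop :=
  A^T = A /\ forall x : 'cV[R]_m, x != 0 -> 0 < (x^T *m A *m x) 0 0.

(* [conform_mx 0] only transports a matrix along the equality between the tail
   (or head) of the arc and i; its default value 0 is never reached. *)
Definition coupling_block (R : realType) (N M : nat) (a : 'I_M -> 'I_N * 'I_N)
    (n : 'I_N -> nat) (l : 'I_M -> nat)
    (Cp : forall k : 'I_M, 'M[R]_(l k, n (a k).1))
    (Cm : forall k : 'I_M, 'M[R]_(l k, n (a k).2))
    (k : 'I_M) (i : 'I_N) : 'M[R]_(l k, n i) :=
  if (a k).1 == i then conform_mx 0 (Cp k)
  else if (a k).2 == i then - conform_mx 0 (Cm k)
  else 0.

Definition coupling_mx (R : realType) (N M : nat) (a : 'I_M -> 'I_N * 'I_N)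
    (n : 'I_N -> nat) (l : 'I_M -> nat)
    (Cp : forall k : 'I_M, 'M[R]_(l k, n (a k).1))
    (Cm : forall k : 'I_M, 'M[R]_(l k, n (a k).2)) :
    'M[R]_(\sum_(k < M) l k, \sum_(i < N) n i) :=
  \mxblock_(k < M, i < N) coupling_block Cp Cm k i.

Definition schur_mx (R : realType) (N M : nat) (a : 'I_M -> 'I_N * 'I_N)
    (n : 'I_N -> nat) (l : 'I_M -> nat)
    (B : forall i : 'I_N, 'M[R]_(n i)) (D : forall k : 'I_M, 'M[R]_(l k))
    (Cp : forall k : 'I_M, 'M[R]_(l k, n (a k).1))
    (Cm : forall k : 'I_M, 'M[R]_(l k, n (a k).2)) :
    'M[R]_(\sum_(k < M) l k) :=
  coupling_mx Cp Cm *m invmx (\mxdiag_(i < N) B i) *m (coupling_mx Cp Cm)^T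
  + \mxdiag_(k < M) D k.

Definition out_arcs (N M : nat) (a : 'I_M -> 'I_N * 'I_N) (i : 'I_N) :
    {set 'I_M} :=
  [set k | (a k).1 == i].

Definition inner_vertices (N M : nat) (a : 'I_M -> 'I_N * 'I_N) :
    {set 'I_N} :=
  [set i | out_arcs a i != finset.set0].

Definition out_dim (N M : nat) (a : 'I_M -> 'I_N * 'I_N) (l : 'I_M -> nat)
    (i : 'I_N) : nat :=
  (\sum_(p < #|out_arcs a i|) l (enum_val p))%N.

(* The total size of the system once the arcs are ordered by their tails; it
   equals \sum_k l k, but is not convertible to it. *)
Definition grouped_dim (N M : nat) (a : 'I_M -> 'I_N * 'I_N)
    (l : 'I_M -> nat) : nat :=
  (\sum_(s < #|inner_vertices a|) out_dim a l (enum_val s))%N.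

Definition tail_block (R : realType) (N M : nat) (a : 'I_M -> 'I_N * 'I_N)
    (l : 'I_M -> nat) (S : 'M[R]_(\sum_(k < M) l k)) (i j : 'I_N) :
    'M[R]_(out_dim a l i, out_dim a l j) :=
  \mxblock_(p < #|out_arcs a i|, q < #|out_arcs a j|)
    submxblock S (enum_val p) (enum_val q).

(* S with its arcs reordered so that those with a common tail are contiguous. *)
Definition grouped_mx (R : realType) (N M : nat) (a : 'I_M -> 'I_N * 'I_N)
    (l : 'I_M -> nat) (S : 'M[R]_(\sum_(k < M) l k)) :
    'M[R]_(grouped_dim a l) :=
  \mxblock_(s < #|inner_vertices a|, t < #|inner_vertices a|)
    tail_block a S (enum_val s) (enum_val t).

Definition grouped_diag_mx (R : realType) (N M : nat)
    (a : 'I_M -> 'I_N * 'I_N) (l : 'I_M -> nat)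
    (S : 'M[R]_(\sum_(k < M) l k)) : 'M[R]_(grouped_dim a l) :=
  \mxdiag_(s < #|inner_vertices a|) tail_block a S (enum_val s) (enum_val s).

(* Main.v *)
Require Import Defs.
From HB Require Import structures.
From mathcomp Require Import all_boot all_order all_algebra.
From mathcomp Require Import all_classical all_reals all_analysis.
From mathcomp Require Import ring.

Set Implicit Arguments.
Unset Strict Implicit.
Unset Printing Implicit Defensive.

Import Order.TTheory GRing.Theory Num.Theory.
Import numFieldNormedType.Exports.
Local Open Scope classical_set_scope.
Local Open Scope ring_scope.

(** The iteration is block Jacobi for S, with the blocks given by the groups of
    arcs that leave a common vertex. Write E for Sdiag. It converges as soon as
    both S and 2E - S are positive definite (the splitting S = E - (E - S) is
    then P-regular): if e is the error and w = E^-1 S e, so that the next error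
    is e - w, then the energy e^T S e drops by w^T (2E - S) w at each step. A
    nonnegative sequence that decreases has vanishing decrements, hence
    w -> 0, and e = S^-1 E w -> 0. This is [regular_splitting_cvg].

    What remains is that 2E - S is positive definite, and this is where the tree
    enters. The block of S at two distinct arcs vanishes unless the arcs share a
    vertex ([schur_mx_block_eq0]), because the inverse of B is block diagonal.
    In a rooted tree two distinct arcs never have the same head, so if they have
    different tails and share a vertex, the head of one is the tail of the other,
    and their tails have depths of opposite parity. So S couples different groups
    only when their colors, the parities of the depths of the tails, differ. Let
    J be the diagonal matrix of signs given by the colors. Conjugation by J keeps
    the diagonal blocks and changes the sign of every nonzero block off the
    diagonal: J S J = 2E - S ([grouped_diag_mx_conjE]). Hence 2E - S is
    congruent to S. *)

(** * Positive definite matrices *)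

Lemma posdefmx_unit (R : realType) (m : nat) (A : 'M[R]_m) :
  posdefmx A -> A \in unitmx.
Proof.
case=> _ posA; rewrite unitmxE unitfE; apply/det0P => -[v v0 vA0].
have : v^T != 0 by apply: contraNneq v0 => vT0; rewrite -[v]trmxK vT0 trmx0.
by move/posA; rewrite trmxK vA0 mul0mx mxE ltxx.
Qed.

Lemma posdefmx_ge0 (R : realType) (m : nat) (A : 'M[R]_m) (x : 'cV[R]_m) :
  posdefmx A -> 0 <= (x^T *m A *m x) 0 0.
Proof.
case=> _ posA; have [->|/posA/ltW //] := eqVneq x 0.
by rewrite mulmx0 mxE.
Qed.

Lemma quad_formBE (R : realType) (m : nat) (A : 'M[R]_m) (x u : 'cV[R]_m)
    (s t : R) :
  A^T = A ->
  ((s *: x - t *: u)^T *m A *m (s *: x - t *: u)) 0 0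
  = s ^+ 2 * (x^T *m A *m x) 0 0 - 2 * (s * t) * (u^T *m A *m x) 0 0
    + t ^+ 2 * (u^T *m A *m u) 0 0.
Proof.
move=> symA.
have xu : (x^T *m A *m u) 0 0 = (u^T *m A *m x) 0 0.
  have -> : x^T *m A *m u = (u^T *m A *m x)^T.
    by rewrite !trmx_mul trmxK symA mulmxA.
  exact: mxE.
have -> : (s *: x - t *: u)^T = s *: x^T - t *: u^T by rewrite linearB !linearZ.
rewrite !(mulmxBl, mulmxBr) -!(scalemxAl, scalemxAr).
move: xu; move: (x^T *m A *m x) (x^T *m A *m u) (u^T *m A *m x) (u^T *m A *m u).
by move=> xx xu ux uu xu_ux; rewrite !mxE xu_ux; ring.
Qed.

(** A quantitative form of definiteness that avoids eigenvalues and
    compactness: v is the Q-inner product with u = Q^-1 v^T, and the bound is the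
    Cauchy-Schwarz inequality for that inner product, with constant u^T Q u. *)
Lemma linear_form_le (R : realType) (m : nat) (Q : 'M[R]_m) (v : 'rV[R]_m) :
  posdefmx Q ->
  exists c : R, forall x : 'cV[R]_m,
    ((v *m x) 0 0) ^+ 2 <= c * (x^T *m Q *m x) 0 0.
Proof.
move=> posQ; have [symQ Qgt0] := posQ.
pose u := invmx Q *m v^T.
have uQ : u^T *m Q = v.
  by apply: trmx_inj; rewrite trmx_mul symQ trmxK mulKVmx ?posdefmx_unit.
exists ((u^T *m Q *m u) 0 0) => x.
have [u0|/Qgt0 c_gt0] := eqVneq u 0.
  by rewrite -uQ u0 trmx0 !mul0mx mxE expr0n mul0r.
(* Nonnegativity at c x - (v x) u is the bound multiplied by c = u^T Q u. *)
move: (posdefmx_ge0 ((u^T *m Q *m u) 0 0 *: x - (v *m x) 0 0 *: u) posQ).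
rewrite quad_formBE // uQ; move: c_gt0; rewrite uQ.
move: ((v *m u) 0 0) ((v *m x) 0 0) ((x^T *m Q *m x) 0 0) => c b q c_gt0.
have -> : c ^+ 2 * q - 2 * (c * b) * b + b ^+ 2 * c = c * (c * q - b ^+ 2).
  by ring.
by rewrite pmulr_rge0 // subr_ge0.
Qed.

(** P' witnesses that P is injective, so that x != 0 gives P x != 0. *)
Lemma posdefmx_congr (R : realType) (m n : nat) (A : 'M[R]_m)
    (P : 'M[R]_(m, n)) (P' : 'M[R]_(n, m)) :
  P' *m P = 1%:M -> posdefmx A -> posdefmx (P^T *m A *m P).
Proof.
move=> P'P [symA posA]; split; first by rewrite !trmx_mul trmxK symA mulmxA.
move=> x x0; have Px0 : P *m x != 0.
  by apply: contraNneq x0 => Px0; rewrite -[x]mul1mx -P'P -mulmxA Px0 mulmx0.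
by have := posA _ Px0; rewrite trmx_mul !mulmxA.
Qed.

Lemma posdefmx_mxsub (R : realType) (m n : nat) (A : 'M[R]_m)
    (f : 'I_n -> 'I_m) :
  injective f -> posdefmx A -> posdefmx (mxsub f f A).
Proof.
move=> f_inj posA; pose P : 'M[R]_(m, n) := colsub f 1%:M.
have trP : P^T = rowsub f 1%:M by rewrite trmx_mxsub trmx1.
have -> : mxsub f f A = P^T *m A *m P.
  by rewrite trP -rowsubE mulmx_colsub mulmx1 mxsubcr.
apply: (@posdefmx_congr _ _ _ _ _ P^T) posA; rewrite trP.
by rewrite -rowsubE -mxsubrc; apply/matrixP => i j; rewrite !mxE (inj_eq f_inj).
Qed.

(** * Convergence of P-regular splittings *)

Lemma cvg_mx (R : realType) (m n : nat) (u : nat -> 'M[R]_(m, n))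
    (L : 'M[R]_(m, n)) :
  (forall i j, (fun k => u k i j) @ \oo --> L i j) -> u @ \oo --> L.
Proof.
move=> uL A [P LP PA].
apply: (@filterS _ \oo _ [set k | forall i j, P i j (u k i j)]).
  by move=> k Pk; exact: PA.
have nearP i : \forall k \near \oo, forall j, P i j (u k i j).
  by apply: filter_forall => j; exact: uL (LP i j).
exact: filter_forall nearP.
Qed.

(** V converges, being nonincreasing and bounded below, so its decrements tend
    to 0. *)
Lemma cvg0_sqr_le_decrement (R : realType) (x V : nat -> R) (c : R) :
  (forall k, 0 <= V k) -> (forall k, V k.+1 <= V k) ->
  (forall k, x k ^+ 2 <= c * (V k - V k.+1)) -> x @ \oo --> (0 : R).
Proof.
move=> V0 VS xV.
have cV : cvgn V.
  apply: nonincreasing_is_cvgn.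
    by apply/nonincreasing_seqP.
  by exists 0 => _ [k _ <-].
have gap0 : (fun k => c * (V k - V k.+1)) @ \oo --> (0 : R).
  rewrite -[X in _ --> X](mulr0 c) -[X in c * X](subrr (limn V)).
  apply: cvgMr => //; apply: cvgB => //.
  by rewrite (cvg_shiftS V).
have x2 : (fun k => x k ^+ 2) @ \oo --> (0 : R).
  apply: (squeeze_cvgr _ (cvg_cst 0) gap0).
  by apply: nearW => k; rewrite sqr_ge0 xV.
apply/norm_cvg0P.
have -> : (fun k => `|x k|) = (fun k => Num.sqrt (x k ^+ 2)).
  by apply/funext => k; rewrite sqrtr_sqr.
rewrite -[X in _ --> X](sqrtr0 R).
by apply: continuous_cvg => //; exact: sqrt_continuous.
Qed.

(** V is the energy of the error e. Each coordinate of e = A^-1 E w is a linear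
    form in w, so its square is at most a constant times the quadratic form of
    2E - A at w, which is the decrement of V. *)
Lemma regular_splitting_cvg (R : realType) (m : nat) (A E : 'M[R]_m)
    (f y0 : 'cV[R]_m) :
  posdefmx A -> posdefmx (E *+ 2 - A) ->
  (fun k : nat => iter k (fun y => y + invmx E *m (f - A *m y)) y0)
    @ \oo --> invmx A *m f.
Proof.
move=> posA posQ; have [symA _] := posA.
have uA := posdefmx_unit posA.
(* 2E is the sum of A and 2E - A, hence positive definite. *)
have uE : E \in unitmx.
  have : posdefmx (E *+ 2).
    split; first by have := posQ.1; rewrite linearB /= symA => /addIr.
    move=> x x0; rewrite -[E *+ 2](subrK A) mulmxDr mulmxDl mxE.
    by rewrite addr_gt0 ?posA.2 ?posQ.2.
  move/posdefmx_unit; rewrite -scaler_nat unitmxZ // unitfE.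
  by rewrite pnatr_eq0.
pose y k := iter k (fun y => y + invmx E *m (f - A *m y)) y0.
pose e k := y k - invmx A *m f.
pose w k := invmx E *m (A *m e k).
have eS k : e k.+1 = e k - w k.
  rewrite /e /y iterS -/(y k) /w.
  have -> : f - A *m y k = - (A *m e k) by rewrite mulmxBr mulKVmx // opprB.
  by rewrite mulmxN addrAC.
pose V k := ((e k)^T *m A *m e k) 0 0.
have VS k : V k.+1 = V k - ((w k)^T *m (E *+ 2 - A) *m w k) 0 0.
  have := quad_formBE (e k) (w k) 1 1 symA; rewrite !scale1r -eS -/(V k.+1) => ->.
  have -> : (w k)^T *m A *m e k = (w k)^T *m E *m w k.
    by rewrite -!mulmxA mulKVmx.
  rewrite (mulmxBr (w k)^T) mulmxBl mulr2n (mulmxDr (w k)^T) mulmxDl -/(V k).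
  move: ((w k)^T *m E *m w k) ((w k)^T *m A *m w k) => wEw wAw.
  by rewrite !mxE; ring.
apply: cvg_mx => i j.
rewrite -[X in _ --> X]add0r.
have -> : (fun k => y k i j) = (fun k => e k i j + (invmx A *m f) i j).
  by apply/funext => k; rewrite /e mxE [X in _ + X + _]mxE subrK.
apply: cvgD; last exact: cvg_cst.
have [c cQ] := linear_form_le (delta_mx 0 i *m invmx A *m E) posQ.
apply: (@cvg0_sqr_le_decrement _ _ V c) => k.
- exact: posdefmx_ge0.
- by rewrite VS gerBl posdefmx_ge0.
- rewrite VS opprB addrC subrK.
  have -> : e k i j = ((delta_mx 0 i : 'rV_m) *m invmx A *m E *m w k) 0 0.
    by rewrite -!mulmxA mulKVmx // mulKmx // -rowE [RHS]mxE (ord1 j).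
  exact: cQ.
Qed.

(** * Sparsity of the Schur complement *)

Lemma mxdiag_unitmx (R : comUnitRingType) (N : nat) (n : 'I_N -> nat)
    (B : forall i, 'M[R]_(n i)) (i : 'I_N) :
  \mxdiag_i B i \in unitmx -> B i \in unitmx.
Proof.
move=> uB; have := mulVmx uB; rewrite -[invmx _]submxblockK mul_mxblock_mxdiag.
rewrite -mxdiagZ => /(congr1 (fun X => submxblock X i i)).
by rewrite mxblockK submxblock_diag => /mulmx1_unit[].
Qed.

Lemma invmx_mxdiag (R : comUnitRingType) (N : nat) (n : 'I_N -> nat)
    (B : forall i, 'M[R]_(n i)) :
  \mxdiag_i B i \in unitmx -> invmx (\mxdiag_i B i) = \mxdiag_i invmx (B i).
Proof.
move=> uB; rewrite -[RHS](mulKmx uB).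
have -> : \mxdiag_i B i *m \mxdiag_i invmx (B i) = 1%:M.
  rewrite mul_mxdiag_mxblock -mxdiagZ; apply/eq_mxblockP => i j.
  case: eqP => [<-|_]; last by rewrite mulmx0.
  by rewrite !conform_mx_id mulmxV // mxdiag_unitmx.
by rewrite mulmx1.
Qed.

(** Since B^-1 is block diagonal, the block of C B^-1 C^T at (k, k') is a sum
    over the vertices incident with both arcs. *)
Lemma schur_mx_block_eq0 (R : realType) (N M : nat) (a : 'I_M -> 'I_N * 'I_N)
    (n : 'I_N -> nat) (l : 'I_M -> nat)
    (B : forall i : 'I_N, 'M[R]_(n i)) (D : forall k : 'I_M, 'M[R]_(l k))
    (Cp : forall k : 'I_M, 'M[R]_(l k, n (a k).1))
    (Cm : forall k : 'I_M, 'M[R]_(l k, n (a k).2)) (k k' : 'I_M) :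
  \mxdiag_i B i \in unitmx ->
  (a k).1 != (a k').1 -> (a k).1 != (a k').2 ->
  (a k).2 != (a k').1 -> (a k).2 != (a k').2 ->
  submxblock (schur_mx B D Cp Cm) k k' = 0.
Proof.
move=> uB tt th ht hh; rewrite submxblockD mxblockK ifN; last first.
  by apply: contra_neq tt => ->.
rewrite addr0 invmx_mxdiag // mul_mxblock_mxdiag tr_mxblock mul_mxblock mxblockK.
apply: big1 => i _; rewrite /coupling_block.
have [<-|_] := eqVneq (a k).1 i.
  by rewrite !(eq_sym _ (a k).1) (negPf tt) (negPf th) trmx0 mulmx0.
have [<-|_] := eqVneq (a k).2 i; last by rewrite !mul0mx.
by rewrite !(eq_sym _ (a k).2) (negPf ht) (negPf hh) trmx0 mulmx0.
Qed.

(** * Arborescences *)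

Lemma dwalk_rcons (N M : nat) (a : 'I_M -> 'I_N * 'I_N) (u v : 'I_N)
    (w : seq 'I_M) (k : 'I_M) :
  dwalk a u (rcons w k) v = dwalk a u w (a k).1 && ((a k).2 == v).
Proof.
by elim: w u => [|k' w IHw] u /=; rewrite ?(eq_sym u) // IHw andbA.
Qed.

(** Two distinct arcs with the same head would be the last arcs of two walks
    from the root to that head. *)
Lemma arborescence_head_inj (N M : nat) (a : 'I_M -> 'I_N * 'I_N) (r : 'I_N) :
  arborescence a r -> injective (fun k => (a k).2).
Proof.
move=> tree k k' hkk'.
have [w [wP _]] := tree (a k).1; have [w' [w'P _]] := tree (a k').1.
have [x [_ x_uniq]] := tree (a k).2.
have xw : x = rcons w k by apply: x_uniq; rewrite dwalk_rcons wP eqxx.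
have xw' : x = rcons w' k' by apply: x_uniq; rewrite dwalk_rcons w'P hkk' eqxx.
by have := congr1 (last k) xw'; rewrite xw !last_rcons.
Qed.

(** The color of a vertex is the parity of its depth: appending an arc to the
    walk from the root to its tail gives the walk from the root to its head. *)
Lemma arborescence_bicolor (N M : nat) (a : 'I_M -> 'I_N * 'I_N) (r : 'I_N) :
  arborescence a r ->
  exists c : 'I_N -> bool, forall k, c (a k).2 = ~~ c (a k).1.
Proof.
move=> tree; pose walk v := sval (cid (tree v)).
have walkP v : unique (fun w => dwalk a r w v) (walk v) := svalP (cid (tree v)).
exists (fun v => odd (size (walk v))) => k.
suff -> : walk (a k).2 = rcons (walk (a k).1) k by rewrite size_rcons.
by apply: (walkP _).2; rewrite dwalk_rcons (walkP _).1 eqxx.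
Qed.

(** * Grouping the arcs by their tails *)

(** The position, in the arc order, of the coordinate u of the grouped order. *)
Definition ungroup (N M : nat) (a : 'I_M -> 'I_N * 'I_N)
    (l : 'I_M -> nat) (u : 'I_(grouped_dim a l)) :
    'I_(\sum_(k < M) l k) :=
  tagnat.Rank (enum_val (tagnat.sig1 (tagnat.sig2 u)))
              (tagnat.sig2 (tagnat.sig2 u)).

Definition arc_of (N M : nat) (a : 'I_M -> 'I_N * 'I_N)
    (l : 'I_M -> nat) (u : 'I_(grouped_dim a l)) :
    'I_M := tagnat.sig1 (ungroup u).

Lemma grouped_mxE (R : realType) (N M : nat) (a : 'I_M -> 'I_N * 'I_N)
    (l : 'I_M -> nat)
    (S : 'M[R]_(\sum_(k < M) l k)) :
  grouped_mx a S = mxsub (@ungroup _ _ a l) (@ungroup _ _ a l) S.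
Proof. by apply/matrixP => u v; rewrite !mxE. Qed.

Lemma tail_enum_val (N M : nat) (a : 'I_M -> 'I_N * 'I_N) (i : 'I_N)
    (p : 'I_#|out_arcs a i|) :
  (a (enum_val p)).1 = i.
Proof. by have := enum_valP p; rewrite inE => /eqP. Qed.

Lemma tail_arc_of (N M : nat) (a : 'I_M -> 'I_N * 'I_N)
    (l : 'I_M -> nat) (u : 'I_(grouped_dim a l)) :
  (a (arc_of u)).1 = enum_val (tagnat.sig1 u).
Proof. by rewrite /arc_of tagnat.Rank1K tail_enum_val. Qed.

(** The tail of the arc of u determines the group of u; within one group the
    enumeration of the arcs is injective. Injectivity makes the grouped matrix a
    principal submatrix up to reordering, hence positive definite. *)
Lemma ungroup_inj (N M : nat) (a : 'I_M -> 'I_N * 'I_N)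
    (l : 'I_M -> nat) :
  injective (@ungroup _ _ a l).
Proof.
move=> u v uv; have := congr1 (fun k => (a (tagnat.sig1 k)).1) uv.
rewrite /= !tail_arc_of => /enum_val_inj same_tail.
rewrite -[u]tagnat.sig2K -[v]tagnat.sig2K; move: uv same_tail; rewrite /ungroup.
move: (tagnat.sig1 u) (tagnat.sig1 v) (tagnat.sig2 u) (tagnat.sig2 v).
move=> s s' t t' + ss'; case: s' / ss' t' => t' tt'.
suff -> : t = t' by [].
rewrite -[t]tagnat.sig2K -[t']tagnat.sig2K.
move: tt'.
move: (tagnat.sig1 t) (tagnat.sig1 t') (tagnat.sig2 t) (tagnat.sig2 t').
move=> p p' q q' /(congr1 val)/eqP; rewrite /= tagnat.eq_Rank.
case/andP => /eqP/enum_val_inj pp'; case: p' / pp' q' => q' /eqP/val_inj qq'.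
by rewrite qq'.
Qed.

Lemma grouped_diag_mxE (R : realType) (N M : nat) (a : 'I_M -> 'I_N * 'I_N)
    (l : 'I_M -> nat)
    (S : 'M[R]_(\sum_(k < M) l k))
    (u v : 'I_(grouped_dim a l)) :
  grouped_diag_mx a S u v =
  if (a (arc_of u)).1 == (a (arc_of v)).1 then grouped_mx a S u v else 0.
Proof.
rewrite !tail_arc_of (inj_eq enum_val_inj) !mxE.
move: (tagnat.sig1 u) (tagnat.sig1 v) (tagnat.sig2 u) (tagnat.sig2 v).
move=> s s' t t'; case: eqP t' => [<-|_] t'; last by rewrite mxE.
by rewrite conform_mx_id !mxE.
Qed.

(** Entries within a group are kept on both sides. Entries between groups are
    0 in the block diagonal part, and their sign changes on both sides: either
    the colors differ and conjugation by J multiplies by -1, or the entry is 0. *)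
Lemma grouped_diag_mx_conjE (R : realType) (N M : nat) (a : 'I_M -> 'I_N * 'I_N)
    (l : 'I_M -> nat) (S : 'M[R]_(\sum_(k < M) l k)) (c : 'I_N -> bool) :
  (forall k k' : 'I_M, (a k).1 != (a k').1 -> c (a k).1 = c (a k').1 ->
    submxblock S k k' = 0) ->
  let J := diag_mx (\row_u (-1) ^+ c (a (@arc_of _ _ a l u)).1) in
  grouped_diag_mx a S *+ 2 - grouped_mx a S = J *m grouped_mx a S *m J.
Proof.
move=> S0 J; apply/matrixP => u v.
have -> (X Y : 'M[R]_(grouped_dim a l)) : (X *+ 2 - Y) u v = X u v *+ 2 - Y u v.
  by rewrite mulr2n !mxE mulr2n.
have -> (X : 'M[R]_(grouped_dim a l)) : (J *m X *m J) u v =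
    (-1) ^+ c (a (arc_of u)).1 * X u v * (-1) ^+ c (a (arc_of v)).1.
  by rewrite mul_mx_diag mul_diag_mx !mxE.
rewrite grouped_diag_mxE; have [->|tails] := eqVneq (a (arc_of u)).1 _.
  by rewrite mulr2n addrK mulrAC -signr_addb addbb mul1r.
rewrite mul0rn sub0r.
have [same_color|] := eqVneq (c (a (arc_of u)).1) (c (a (arc_of v)).1).
  have -> : grouped_mx a S u v = submxblock S (arc_of u) (arc_of v)
      (tagnat.sig2 (ungroup u)) (tagnat.sig2 (ungroup v)).
    by rewrite grouped_mxE [LHS]mxE [RHS]mxE /arc_of !tagnat.sig2K.
  by rewrite S0 // mxE mulr0 mul0r oppr0.
case: (c _) (c _) => [] [] //= _;
  by rewrite ?expr0 ?expr1 !(mulN1r, mul1r, mulrN1, mulr1).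
Qed.

Theorem corollary4p2 (R : realType) (N M : nat)
    (a : 'I_M -> 'I_N * 'I_N) (r : 'I_N)
    (n : 'I_N -> nat) (l : 'I_M -> nat)
    (B : forall i : 'I_N, 'M[R]_(n i))
    (D : forall k : 'I_M, 'M[R]_(l k))
    (Cp : forall k : 'I_M, 'M[R]_(l k, n (a k).1))
    (Cm : forall k : 'I_M, 'M[R]_(l k, n (a k).2))
    (tree_a : arborescence a r)
    (symB : forall i : 'I_N, (B i)^T = B i)
    (symD : forall k : 'I_M, (D k)^T = D k)
    (unitB : \mxdiag_(i < N) B i \in unitmx)
    (posS : posdefmx (schur_mx B D Cp Cm))
    (fx y0 : 'cV[R]_(grouped_dim a l)) :
  let S := grouped_mx a (schur_mx B D Cp Cm) in
  let Sdiag := grouped_diag_mx a (schur_mx B D Cp Cm) in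
  (fun k : nat => iter k (fun y => y + invmx Sdiag *m (fx - S *m y)) y0)
    @ \oo --> invmx S *m fx.
Proof.
have [c c_alt] := arborescence_bicolor tree_a.
have head_inj := arborescence_head_inj tree_a.
set S0 := schur_mx B D Cp Cm => S Sdiag.
have posS' : posdefmx S.
  by rewrite /S grouped_mxE; exact/posdefmx_mxsub/posS/ungroup_inj.
apply: regular_splitting_cvg => //.
rewrite /S /Sdiag (@grouped_diag_mx_conjE _ _ _ _ _ _ c).
  set J := diag_mx _.
  have trJ : J^T = J by rewrite tr_diag_mx.
  rewrite -{1}trJ; apply: (posdefmx_congr (P' := J)) posS'.
  apply/matrixP => u v; rewrite mul_diag_mx !mxE.
  by case: eqP => [->|]; rewrite ?mulr0 // !mulr1n -signr_addb addbb.
(* The head of an arc has the color opposite to that of its tail, so it cannot be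
   the tail of an arc whose tail has the same color. *)
move=> k k' tt same_color; apply: schur_mx_block_eq0 => //.
- by apply: contra_eq_neq same_color => ->; rewrite c_alt; case: (c _).
- by apply: contra_eq_neq same_color => <-; rewrite c_alt; case: (c _).
- by apply: contra_neq tt => /head_inj ->.
Qed.
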